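(* Consider the $G/M/\infty$ queue with FIFO-batch or LIFO-batch departures, and suppose that the arrival process is Poisson of rate $\lambda$. Let $Q_\infty$ have the stationary queue-length distribution and let $m_0:=1$, $m_n:=\mathbb{E}\prod_{i=0}^{n-1}(Q_\infty-i)$, $n\ge 1$, be its factorial moments. Then $$m_{n+2}=(n+2)(\rho m_n-m_{n+1}),\quad n\ge 0.$$
   Context: Model. Customers arrive to an infinite-server system according to a Poisson process of rate $\lambda>0$; each arriving customer immediately starts service at his own server; service times are i.i.d. exponential with parameter $\mu>0$, independent of arrivals. Customers line up in order of arrival. Under FIFO-batch (respectively LIFO-batch) departures, whenever the service of some customer finishes, this customer leaves together with all customers in front of (respectively behind) him. Under either discipline the queue length $Q(\cdot)$ is a continuous-time Markov chain on $\mathbb{Z}_+$ with transition rates $q(i,i+1)=\lambda$, $i\ge 0$, and $q(i,j)=\mu$, $i\ge 1$, $0\le j\le i-1$. Its stationary distribution is $\pi_k=\mathbb{P}\{Q_\infty=k\}$, $k\in\mathbb{Z}_+$. $\rho:=\lambda/\mu$. *)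

(* Defs.v *)
From mathcomp Require Import all_boot all_order all_algebra.
From mathcomp Require Import all_classical all_reals all_analysis.
From mathcomp Require Import zify.

Set Implicit Arguments.
Unset Strict Implicit.
Unset Printing Implicit Defensive.

Import Order.TTheory GRing.Theory Num.Theory.
Import numFieldNormedType.Exports.

Local Open Scope classical_set_scope.
Local Open Scope ring_scope.

Inductive discipline := FIFO_batch | LIFO_batch.

(* Queue length right after a service completion by the customer who has p
   customers in front of him, the queue length just before being i > p. *)
Definition queue_after (disc : discipline) (i p : nat) : nat :=
  match disc with
  | FIFO_batch => (i - p.+1)%N
  | LIFO_batch => p
  end.

(* Off-diagonal transition rates: an arrival at rate lambda, and a service
   completion at rate mu for each of the i customers present; see batch_rateE
   for the closed form. *)
Definition batch_rate (R : realType) (disc : discipline) (lambda mu : R)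
    (i j : nat) : R :=
  (if j == i.+1 then lambda else 0)
  + \sum_(p < i | queue_after disc i p == j) mu.

Lemma batch_rateE (R : realType) (disc : discipline) (lambda mu : R)
    (i j : nat) :
  batch_rate disc lambda mu i j =
  if j == i.+1 then lambda else if (j < i)%N then mu else 0.
Proof.
rewrite /batch_rate; case: (ltnP j i) => [ji|ij].
  have -> : (j == i.+1) = false by apply/eqP; lia.
  rewrite add0r; case: disc => /=.
    have hk : (i - j.+1 < i)%N by lia.
    rewrite (big_pred1 (Ordinal hk)) // => p /=.
    rewrite -val_eqE /=; have := ltn_ord p => pi.
    by apply/eqP/eqP; lia.
  by rewrite (big_pred1 (Ordinal ji)) // => p /=; rewrite -val_eqE.
rewrite big_pred0 ?addr0 // => p.
have pi := ltn_ord p.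
by case: disc => /=; apply/eqP; lia.
Qed.

(* p t i A is the probability of being in A at time t when started from i;
   nothing is required of p t for t < 0. *)
Record transition_semigroup (R : realType) (p : R -> R.-pker nat ~> nat)
    : Prop := TransitionSemigroup {
  semigroup0 : forall (i : nat) (A : set nat), p 0 i A = \d_i A ;
  semigroupD : forall (s t : R) (i : nat) (A : set nat), 0 <= s -> 0 <= t ->
    p (s + t) i A = (\int[p s i]_k p t k A)%E }.

(* The right derivative of p at time 0 is the conservative Q-matrix whose
   off-diagonal entries are the q i j. *)
Definition has_rates (R : realType) (p : R -> R.-pker nat ~> nat)
    (q : nat -> nat -> R) : Prop :=
  (forall i j : nat, i != j ->
     (p t i [set j] * (t^-1)%:E)%E @[t --> 0^'+] --> (q i j)%:E) /\
  (forall i : nat,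
     ((1 - p t i [set i]) * (t^-1)%:E)%E @[t --> 0^'+] -->
       (\sum_(0 <= j <oo | j != i) (q i j)%:E)%E).

Definition stationary (R : realType) (p : R -> R.-pker nat ~> nat)
    (pi : probability nat R) : Prop :=
  forall (t : R) (A : set nat), 0 <= t -> (\int[pi]_i p t i A)%E = pi A.

(* The factors are real, not truncated, differences. *)
Definition factorial_moment (R : realType) (d : measure_display)
    (T : measurableType d) (P : probability T R) (X : T -> nat) (n : nat)
    : \bar R :=
  ('E_P[fun w : T => (\prod_(i < n) ((X w)%:R - i%:R))%R])%E.

(* Main.v *)
Require Import Defs.
From mathcomp Require Import all_boot all_order all_algebra.
From mathcomp Require Import all_classical all_reals all_analysis.
From mathcomp Require Import zify ring lra.

Set Implicit Arguments.
Unset Strict Implicit.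
Unset Printing Implicit Defensive.

Import Order.TTheory GRing.Theory Num.Theory.
Import numFieldNormedType.Exports.

Local Open Scope classical_set_scope.
Local Open Scope ring_scope.

(** The recurrence comes from balancing the probability flow across each cut
    between {0, ..., N} and {N + 1, N + 2, ...}.  Upward, the cut is crossed only
    by an arrival at N, at rate lambda.  Downward, it is crossed from every i > N,
    and the chain then lands on each of the N + 1 states below the cut at rate mu.
    Hence, with pi the stationary distribution,

      rho pi_N = (N + 1) pi{N + 1, N + 2, ...}              (tail_balance).

    Multiply this by the falling factorial N ^_ n, sum over N, and exchange the
    order of summation on the right.  Since (N + 1) N ^_ n = (N + 1) ^_ (n + 1),
    the weight collected by pi_i is the sum of (j + 1) ^_ (n + 1) over j < i, which
    is (i + 1) ^_ (n + 2) / (n + 2) = i ^_ (n + 2) / (n + 2) + i ^_ (n + 1).  Thus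

      rho m_n = m_(n+2) / (n + 2) + m_(n+1)                 (moment_balance),

    an identity between nonnegative, possibly infinite numbers.  It bounds m_(n+1)
    by rho m_n, so all moments are finite, and m_(n+1) can be subtracted.

    The delicate point is the flow balance itself.  Stationarity is an assumption
    on the transition probabilities, whereas the rates are unbounded derivatives
    at time 0.  For every t > 0 the mass that enters a set A during a time t equals
    the mass that leaves it (inflow_outflow).  Divide by t and let t tend to 0 with
    A = {0, ..., N}.  The outflow involves finitely many states and converges.
    For the inflow, Fatou's lemma gives one inequality at once; for the batch
    queue it reads (N + 1) pi{N + 1, ...} <= rho pi_N, and already implies that pi
    has a finite mean.  The probability of leaving i during a time t is
    subadditive in t, hence at most t times the exit rate lambda + i mu of i
    (leave_rate_le).  As lambda + i mu is pi-integrable, dominated convergence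
    turns the inequality into an equality (flow_balance). *)

(** * Transition probabilities *)

Lemma integral_set1_nat (R : realType) (m : {measure set nat -> \bar R})
    (i : nat) (f : nat -> \bar R) :
  (\int[m]_(k in [set i]) f k = f i * m [set i])%E.
Proof.
rewrite -(integral_cst m (D := [set i])) //.
by apply: eq_integral => k; rewrite inE => /= ->.
Qed.

(** Real-valued transition probabilities, so that they can be subtracted and
    divided by a time. *)
Definition tprob (R : realType) (p : R -> R.-pker nat ~> nat) (t : R) (i : nat)
  (A : set nat) : R := fine (p t i A).

Section transition_function.
Context (R : realType) (p : R -> R.-pker nat ~> nat).
Implicit Types (t : R) (i j n : nat) (A : set nat).

Lemma kernel_le1 t i A : (p t i A <= 1)%E.
Proof.
by rewrite -(prob_kernel (s := p t) i); apply: le_measure; rewrite ?inE.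
Qed.

Lemma tprobE t i A : p t i A = (tprob p t i A)%:E.
Proof.
rewrite /tprob fineK // ge0_fin_numE //.
exact: le_lt_trans (kernel_le1 t i A) (ltry _).
Qed.

Lemma tprob_ge0 t i A : 0 <= tprob p t i A.
Proof. by rewrite -lee_fin -tprobE. Qed.

Lemma tprob_le1 t i A : tprob p t i A <= 1.
Proof. by rewrite -lee_fin -tprobE kernel_le1. Qed.

Lemma le_tprob t i A B : A `<=` B -> tprob p t i A <= tprob p t i B.
Proof. by move=> AB; rewrite -lee_fin -!tprobE le_measure ?inE. Qed.

Lemma tprobU t i A B : A `&` B = set0 ->
  tprob p t i (A `|` B) = tprob p t i A + tprob p t i B.
Proof.
by move=> AB; apply: EFin_inj; rewrite EFinD -!tprobE measureU.
Qed.

Lemma tprob_ordinal t i n :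
  tprob p t i `I_n = \sum_(j < n) tprob p t i [set nat_of_ord j].
Proof.
elim: n => [|n IH]; first by rewrite big_ord0 II0 /tprob measure0.
rewrite IIS tprobU ?big_ord_recr /= ?IH//.
by apply/seteqP; split=> // k /= [/[swap] ->]; rewrite ltnn.
Qed.

Lemma tprobC t i A : tprob p t i (~` A) = 1 - tprob p t i A.
Proof.
have := tprobU t i (setICr A); rewrite setUv {1}/tprob prob_kernel /= => ->.
by rewrite addrC addKr.
Qed.

Hypothesis p_semigroup : transition_semigroup p.

(** One way to be at i at time s + t is to be at i at time s as well. *)
Lemma stay_supermultiplicative s t i : 0 <= s -> 0 <= t ->
  tprob p s i [set i] * tprob p t i [set i] <= tprob p (s + t) i [set i].
Proof.
move=> s0 t0; rewrite -lee_fin EFinM -!tprobE (semigroupD p_semigroup)// muleC.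
rewrite -(integral_set1_nat _ i (fun k => p t k [set i])).
exact: ge0_subset_integral.
Qed.

(** With a and b the two probabilities of staying, this is
    1 - a b <= (1 - a) + (1 - b), which holds since (1 - a)(1 - b) >= 0. *)
Lemma leave_subadditive s t i : 0 <= s -> 0 <= t ->
  1 - tprob p (s + t) i [set i] <=
  (1 - tprob p s i [set i]) + (1 - tprob p t i [set i]).
Proof.
move=> s0 t0; have := stay_supermultiplicative i s0 t0.
have := tprob_le1 s i [set i]; have := tprob_le1 t i [set i]; nra.
Qed.

Lemma leave_muln t i n : 0 <= t ->
  1 - tprob p (t *+ n) i [set i] <= (1 - tprob p t i [set i]) *+ n.
Proof.
move=> t0; elim: n => [|n IH].
  rewrite !mulr0n /tprob (semigroup0 p_semigroup) diracE.
  by rewrite mem_set //= subrr.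
rewrite !mulrS (le_trans (leave_subadditive _ _ _)) ?mulrn_wge0// lerD2l//.
Qed.

End transition_function.

(** * Derivatives at time 0 *)

Section rates.
Context (R : realType) (p : R -> R.-pker nat ~> nat) (q : nat -> nat -> R).
Hypothesis p_rates : has_rates p q.

Lemma cvg_jump i j : i != j -> tprob p t i [set j] / t @[t --> 0^'+] --> q i j.
Proof.
move=> ij; have /fine_cvg := (p_rates.1 i j ij).
apply: cvg_trans; apply: near_eq_cvg.
by near=> t; rewrite /= tprobE -EFinM.
Unshelve. all: by end_near. Qed.

Section exit_rate.
Variables (i : nat) (e : R).
Hypothesis exit_rate : (\sum_(0 <= j <oo | j != i) (q i j)%:E)%E = e%:E.

Lemma cvg_leave : (1 - tprob p t i [set i]) / t @[t --> 0^'+] --> e.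
Proof.
have := p_rates.2 i; rewrite exit_rate => /fine_cvg.
apply: cvg_trans; apply: near_eq_cvg.
by near=> t; rewrite /= tprobE -EFinB -EFinM.
Unshelve. all: by end_near. Qed.

(** A subadditive function with derivative e at 0 lies below the line of slope e:
    the quotient over t is at most the quotient over t / k for every k > 0, and
    the latter tends to e.  This bound, uniform in t, is what makes dominated
    convergence possible in spite of the unbounded rates. *)
Lemma leave_rate_le t : transition_semigroup p -> 0 < t ->
  (1 - tprob p t i [set i]) / t <= e.
Proof.
move=> p_semigroup t0; pose v k := t / k.+1%:R.
have v0 k : 0 < v k by rewrite divr_gt0.
have cv : v n @[n --> \oo] --> 0.
  by rewrite -(mulr0 t); apply: cvgMr; exact: cvg_harmonic.
have := (cvg_at_rightP _ _ _).1 cvg_leave v (conj v0 cv).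
move=> /cvgr_to_ge; apply; near=> k.
rewrite ler_pdivrMr//.
have := leave_muln p_semigroup i k.+1 (ltW (v0 k)).
rewrite -(mulr_natr (v k)) divfK ?pnatr_eq0// => /le_trans; apply.
rewrite -mulr_natr /v invf_div le_eqVlt; apply/orP; left; apply/eqP.
by field; rewrite gt_eqF.
Unshelve. all: by end_near. Qed.

(** The limit is the total rate from i to the outside of {0, ..., n - 1}.  It is
    written as a difference because only finitely many of the jump probabilities
    can be differentiated one by one; the rest is what remains of the exit
    rate, and it is here that conservativity of the rates is used. *)
Lemma cvg_exit n : (i < n)%N ->
  (1 - tprob p t i `I_n) / t @[t --> 0^'+] -->
    e - \sum_(j < n | j != i :> nat) q i j.
Proof.
move=> ilen.
rewrite (_ : (fun t => _) = fun t => (1 - tprob p t i [set i]) / t -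
   \sum_(j < n | j != i :> nat) tprob p t i [set nat_of_ord j] / t).
  apply: cvgB; first exact: cvg_leave.
  apply: cvg_big => [|j ji]; first exact: add_continuous.
  by apply: cvg_jump; rewrite eq_sym.
apply/funext => t; rewrite tprob_ordinal (bigD1 (Ordinal ilen)) //=.
by rewrite -mulr_suml -mulrBl; congr (_ / _); rewrite opprD addrA.
Qed.

End exit_rate.

Lemma cvg_enter n i : (n <= i)%N ->
  tprob p t i `I_n / t @[t --> 0^'+] --> \sum_(j < n) q i j.
Proof.
move=> ni.
rewrite (_ : (fun t => _) = fun t =>
   \sum_(j < n) tprob p t i [set nat_of_ord j] / t).
  apply: cvg_big => [|j _]; first exact: add_continuous.
  by apply: cvg_jump; rewrite gtn_eqF// (leq_trans (ltn_ord j)).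
by apply/funext => t; rewrite tprob_ordinal mulr_suml.
Qed.

End rates.

(** * Rates of the batch queue *)

Section batch_rates.
Context (R : realType) (disc : discipline) (lambda mu : R).

Lemma sum_batch_rate (n i : nat) :
  \sum_(j < n | j != i :> nat) batch_rate disc lambda mu i j =
  (minn i n)%:R * mu + (if (i.+1 < n)%N then lambda else 0).
Proof.
elim: n => [|n IH]; first by rewrite big_ord0 minn0 mul0r addr0.
rewrite big_mkcond big_ord_recr /= -big_mkcond /= {}IH batch_rateE.
have [lt_ni|lt_in|->] := ltngtP n i.
- have -> : minn i n.+1 = n.+1 by lia.
  have -> : (n == i.+1) = false by lia.
  have -> : (i.+1 < n)%N = false by lia.
  have -> : (i.+1 < n.+1)%N = false by lia.
  by rewrite !addr0 mulrSr mulrDl mul1r.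
- have -> : minn i n.+1 = i by lia.
  have -> : (i.+1 < n.+1)%N = (n == i.+1) || (i.+1 < n)%N by lia.
  by have [->|_] := eqVneq n i.+1; rewrite ?ltnn addr0.
- have -> : minn i i.+1 = i by lia.
  have -> : (i.+1 < i)%N = false by lia.
  by rewrite ltnn !addr0.
Qed.

Lemma batch_exit_rate (i : nat) : 0 <= lambda -> 0 <= mu ->
  (\sum_(0 <= j <oo | j != i) (batch_rate disc lambda mu i j)%:E)%E =
  (lambda + i%:R * mu)%:E.
Proof.
move=> l0 m0.
rewrite eseries_mkcond (nneseries_split 0 i.+2) ?add0n; last first.
  move=> k _; case: ifP => // _; rewrite batch_rateE lee_fin.
  by case: ifP => // _; case: ifP.
rewrite eseries0 ?adde0; last first.
  move=> k /= ik _; case: ifP => // _; rewrite batch_rateE.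
  by rewrite !ifN//; lia.
rewrite big_mkord -big_mkcond /= sumEFin sum_batch_rate ltnSn.
by rewrite (minn_idPl _) 1?addrC//; lia.
Qed.

(** From within {0, ..., N}, only an arrival at N leads outside. *)
Lemma batch_outrate (N i : nat) : (i <= N)%N ->
  lambda + i%:R * mu -
    \sum_(j < N.+1 | j != i :> nat) batch_rate disc lambda mu i j =
  if i == N then lambda else 0.
Proof.
move=> iN; rewrite sum_batch_rate (minn_idPl _); last by lia.
rewrite ltnS; have [->|] := eqVneq i N; first by rewrite ltnn addr0 addrK.
by rewrite ltn_neqAle iN => -> /=; rewrite [lambda + _]addrC subrr.
Qed.

Lemma batch_inrate (n i : nat) : (n <= i)%N ->
  \sum_(j < n) batch_rate disc lambda mu i j = n%:R * mu.
Proof.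
move=> ni; rewrite (eq_bigl (fun j : 'I_n => j != i :> nat)); last first.
  by move=> j; rewrite ltn_eqF// (leq_trans (ltn_ord j)).
by rewrite sum_batch_rate (minn_idPr ni) ltnNge (leq_trans ni)// addr0.
Qed.

End batch_rates.

(** * Flow balance for a stationary distribution *)

Section stationary_flow.
Context (R : realType) (p : R -> R.-pker nat ~> nat) (q : nat -> nat -> R).
Context (pi : probability nat R) (e : nat -> R).
Hypothesis p_semigroup : transition_semigroup p.
Hypothesis p_rates : has_rates p q.
Hypothesis exit_rate :
  forall i, (\sum_(0 <= j <oo | j != i) (q i j)%:E)%E = (e i)%:E.
Hypothesis pi_stationary : stationary p pi.
Local Open Scope ereal_scope.

(* The convergence theorems are about sequences, so t runs through 1 / (k + 1). *)
Let step (k : nat) : R := (k.+1%:R^-1)%R.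

Let step_gt0 k : (0 < step k)%R. Proof. by rewrite invr_gt0. Qed.

Let cvg_step (f : R -> R) (l : R) :
  f t @[t --> 0%R^'+] --> l -> f (step k) @[k --> \oo] --> l.
Proof.
move=> /cvg_at_rightP; apply; split => //; exact: cvg_harmonic.
Qed.

Let exit_rate_ge0 i : (0 <= e i)%R.
Proof.
apply: le_trans (leave_rate_le p_rates (exit_rate i) p_semigroup ltr01).
by rewrite divr1 subr_ge0 tprob_le1.
Qed.

(** The mass of A at time 0 and its mass at time t are equal; both contain the mass
    that is in A at both times, and it is finite, so it cancels. *)
Lemma inflow_outflow (t : R) (A : set nat) : (0 <= t)%R ->
  \int[pi]_(i in ~` A) (tprob p t i A)%:E =
  \int[pi]_(i in A) (1 - tprob p t i A)%:E.
Proof.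
move=> t0; pose stayed := \int[pi]_(i in A) (tprob p t i A)%:E.
have stayed_fin : stayed \is a fin_num.
  rewrite ge0_fin_numE ?integral_ge0//; last first.
    by move=> i _; rewrite lee_fin tprob_ge0.
  apply: (@le_lt_trans _ _ (\int[pi]_(i in A) cst 1 i)).
    apply: ge0_le_integral => // i _; rewrite lee_fin ?tprob_ge0//.
    exact: tprob_le1.
  rewrite integral_cst// mul1e (le_lt_trans (probability_le1 _ _))//.
  exact: ltry.
have all_in : stayed + \int[pi]_(i in ~` A) (tprob p t i A)%:E = pi A.
  rewrite -(pi_stationary A t0) -ge0_integral_setU//.
  - by rewrite setUv; apply: eq_integral => i _; rewrite tprobE.
  - by move=> i _; rewrite lee_fin tprob_ge0.
  - by apply/disj_setPS => i [].
have all_out : stayed + \int[pi]_(i in A) (1 - tprob p t i A)%:E = pi A.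
  rewrite -ge0_integralD//.
  - rewrite -(mul1e (pi A)) -integral_cst//; apply: eq_integral => i _.
    by rewrite -EFinD addrC subrK.
  - by move=> i _; rewrite lee_fin tprob_ge0.
  - by move=> i _; rewrite lee_fin subr_ge0 tprob_le1.
rewrite -[LHS](addeK _ stayed_fin) -[RHS](addeK _ stayed_fin).
by rewrite ![_ + stayed]addeC all_in all_out.
Qed.

Let rescale (D : set nat) (f : nat -> R) k : (forall i, 0 <= f i)%R ->
  \int[pi]_(i in D) (f i / step k)%:E =
  (step k)^-1%:E * \int[pi]_(i in D) (f i)%:E.
Proof.
move=> f0; rewrite -ge0_integralZl_EFin//.
- by apply: eq_integral => i _; rewrite -EFinM mulrC.
- by move=> i _; rewrite lee_fin.
- by rewrite invr_ge0 ltW.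
Qed.

Let inflow_outflow_step (A : set nat) k :
  \int[pi]_(i in ~` A) (tprob p (step k) i A / step k)%:E =
  \int[pi]_(i in A) ((1 - tprob p (step k) i A) / step k)%:E.
Proof.
rewrite !rescale ?inflow_outflow// ?ltW// => i.
  by rewrite subr_ge0 tprob_le1.
exact: tprob_ge0.
Qed.

Let leave_step_le k i : ((1 - tprob p (step k) i [set i]) / step k <= e i)%R.
Proof. exact: (leave_rate_le p_rates (exit_rate i)). Qed.

(** Only finitely many states contribute, so a constant dominates. *)
Lemma cvg_outflow n :
  \int[pi]_(i in `I_n) ((1 - tprob p (step k) i `I_n) / step k)%:E
    @[k --> \oo] -->
  \int[pi]_(i in `I_n) (e i - \sum_(j < n | j != i :> nat) q i j)%:E.
Proof.
apply: (@dominated_cvg _ _ _ pi `I_n _ _ _ (cst (\sum_(j < n) e j)%:E)) => //.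
- move=> i /= ilen; apply: cvg_EFin; first exact: nearW.
  exact: cvg_step (cvg_exit p_rates (exit_rate i) ilen).
- exact: finite_measure_integrable_cst.
- move=> k i /= ilen; rewrite lee_fin ger0_norm; last first.
    by rewrite divr_ge0 ?subr_ge0 ?tprob_le1// ltW.
  apply: (@le_trans _ _ (e i)).
    rewrite (le_trans _ (leave_step_le k i))//.
    rewrite ler_pM2r ?invr_gt0// lerB// le_tprob//.
    by move=> j /= ->.
  rewrite (bigD1 (Ordinal ilen))//= lerDl; exact: sumr_ge0.
Qed.

(** By Fatou's lemma, whatever the integral of the exit rates.  For the batch queue
    the inequality in turn shows that this integral is finite. *)
Lemma inflow_le_outflow n :
  \int[pi]_(i in ~` `I_n) (\sum_(j < n) q i j)%:E <=
  \int[pi]_(i in `I_n) (e i - \sum_(j < n | j != i :> nat) q i j)%:E.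
Proof.
have [<- _] := cvg_limn_einf_sup (cvg_outflow (n := n)).
under [X in _ <= limn_einf X]eq_fun do rewrite -inflow_outflow_step.
apply: le_trans (fatou _ _ _ _) => //; last first.
  by move=> k i _; rewrite lee_fin divr_ge0 ?tprob_ge0// ltW.
rewrite le_eqVlt; apply/orP; left; apply/eqP; apply: eq_integral => i.
rewrite inE => /= /negP; rewrite -leqNgt => ni.
apply/esym; apply: (cvg_limn_einf_sup _).1.
apply: cvg_EFin; first exact: nearW.
exact: cvg_step (cvg_enter p_rates ni).
Qed.

(** Entering {0, ..., n - 1} from i requires leaving i, so the inflow from i is
    dominated by the exit rate of i. *)
Lemma flow_balance n : pi.-integrable setT (EFin \o e) ->
  \int[pi]_(i in ~` `I_n) (\sum_(j < n) q i j)%:E =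
  \int[pi]_(i in `I_n) (e i - \sum_(j < n | j != i :> nat) q i j)%:E.
Proof.
move=> ie; apply: (cvg_unique _ _ (cvg_outflow (n := n))) => //.
rewrite /=; under eq_fun do rewrite -inflow_outflow_step.
apply: (@dominated_cvg _ _ _ pi (~` `I_n) _ _ _ (EFin \o e)) => //.
- move=> i /= /negP; rewrite -leqNgt => ni.
  apply: cvg_EFin; first exact: nearW.
  exact: cvg_step (cvg_enter p_rates ni).
- exact: integrableS ie.
- move=> k i /= ni; rewrite lee_fin ger0_norm; last first.
    by rewrite divr_ge0 ?tprob_ge0// ltW.
  rewrite (le_trans _ (leave_step_le k i))// ler_pM2r ?invr_gt0//.
  rewrite -tprobC le_tprob// => j /= jn ji.
  by apply: ni; rewrite -ji.
Qed.

End stationary_flow.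

(** * Falling factorials and summation by tails *)

Lemma prod_factors_ffact (R : comPzRingType) (k n : nat) :
  \prod_(i < n) (k%:R - i%:R) = (k ^_ n)%:R :> R.
Proof.
elim: n => [|n IH]; first by rewrite big_ord0.
rewrite big_ord_recr /= IH ffactnSr natrM.
(* If k < n, the real factor k - n is negative, but the product before it is 0. *)
have [nk|kn] := leqP n k; first by rewrite natrB.
by rewrite ffact_small// !mul0r.
Qed.

Lemma ffactS_pascal (k n : nat) : k.+1 ^_ n.+1 = (k ^_ n.+1 + n.+1 * k ^_ n)%N.
Proof.
rewrite ffactSS ffactnSr; have [nk|kn] := leqP n k; last first.
  by rewrite ffact_small// !muln0.
by rewrite (mulnC n.+1) -mulnDr mulnC; congr muln; lia.
Qed.

(** The left-hand side telescopes to (i + 1) ^_ (n + 2) by Pascal's rule. *)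
Lemma sum_ffactS (i n : nat) :
  (n.+2 * \sum_(j < i) j.+1 ^_ n.+1 = i ^_ n.+2 + n.+2 * i ^_ n.+1)%N.
Proof.
rewrite -ffactS_pascal; elim: i => [|i IH].
  by rewrite big_ord0 muln0 ffact_small.
by rewrite big_ord_recr /= mulnDr IH -ffactS_pascal.
Qed.

Section sums_against_measure.
Context (R : realType) (m : {measure set nat -> \bar R}) (w : nat -> R).
Hypothesis w_ge0 : forall j, 0 <= w j.
Local Open Scope ereal_scope.

Let integral_series (S : nat -> set nat) :
  \int[m]_i (\sum_(0 <= j <oo) (w j * \1_(S j) i)%:E) =
  \sum_(0 <= j <oo) (w j)%:E * m (S j).
Proof.
rewrite integral_nneseries//; last first.
  by move=> j i _; rewrite lee_fin mulr_ge0.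
apply: eq_eseriesr => j _.
rewrite -[S j in RHS]setIT -integral_indic// -ge0_integralZl_EFin//.
Qed.

Lemma integral_nat_measure :
  \int[m]_i (w i)%:E = \sum_(0 <= j <oo) (w j)%:E * m [set j].
Proof.
rewrite -integral_series; apply: eq_integral => i _.
rewrite (nneseries_split 0 i.+1); last first.
  by move=> k _; rewrite lee_fin mulr_ge0.
rewrite add0n eseries0 ?adde0; last first.
  move=> k /= ik _; rewrite indicE memNset ?mulr0//= => ki.
  by move: ik; rewrite ki ltnn.
rewrite big_nat_recr//= big_nat big1 ?add0e ?indicE ?mem_set ?mulr1//.
move=> k /andP[_ ki]; rewrite indicE memNset ?mulr0//= => ik.
by move: ki; rewrite ik ltnn.
Qed.

(** Tonelli's theorem: the pair j < i is counted at i on the left, at j on the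
    right. *)
Lemma integral_tails :
  \int[m]_i (\sum_(j < i) w j)%:E =
  \sum_(0 <= j <oo) (w j)%:E * m (~` `I_j.+1).
Proof.
rewrite -integral_series; apply: eq_integral => i _.
rewrite (nneseries_split 0 i); last first.
  by move=> k _; rewrite lee_fin mulr_ge0.
rewrite add0n eseries0 ?adde0; last first.
  by move=> k /= ik _; rewrite indicE memNset ?mulr0//=; apply.
rewrite big_mkord -sumEFin; apply: eq_bigr => j _.
by rewrite indicE mem_set ?mulr1//= => /(leq_trans (ltn_ord j)); rewrite ltnn.
Qed.

End sums_against_measure.

(** * Moments of the batch queue *)

Section batch_queue.
Context (R : realType) (disc : discipline) (lambda mu : R).
Context (p : R -> R.-pker nat ~> nat) (pi : probability nat R).
Hypotheses (lambda_gt0 : 0 < lambda) (mu_gt0 : 0 < mu).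
Hypothesis p_semigroup : transition_semigroup p.
Hypothesis p_rates : has_rates p (batch_rate disc lambda mu).
Hypothesis pi_stationary : stationary p pi.
Local Open Scope ereal_scope.

Let rho : R := (lambda / mu)%R.

Let rho_gt0 : (0 < rho)%R. Proof. exact: divr_gt0. Qed.

Let exit_rate i := batch_exit_rate disc i (ltW lambda_gt0) (ltW mu_gt0).

Let inflowE N :
  \int[pi]_(i in ~` `I_N.+1)
    (\sum_(j < N.+1) batch_rate disc lambda mu i j)%:E =
  (N.+1%:R * mu)%:E * pi (~` `I_N.+1).
Proof.
rewrite -integral_cst//; apply: eq_integral => i.
by rewrite inE => /= /negP; rewrite -leqNgt => Ni; rewrite batch_inrate.
Qed.

Let outflowE N :
  \int[pi]_(i in `I_N.+1) (lambda + i%:R * mu -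
    \sum_(j < N.+1 | j != i :> nat) batch_rate disc lambda mu i j)%:E =
  lambda%:E * pi [set N].
Proof.
under eq_integral => i.
  rewrite inE /= ltnS => iN.
  rewrite batch_outrate//. over.
rewrite IIS ge0_integral_setU//.
- rewrite integral_set1_nat eqxx integral0_eq ?add0e// => i /= iN.
  by rewrite ltn_eqF.
- by move=> i _; rewrite lee_fin; case: ifP => // _; exact: ltW.
- by apply/disj_setPS => i [/= iN iE]; rewrite iE ltnn in iN.
Qed.

Lemma tail_le N : N.+1%:R%:E * pi (~` `I_N.+1) <= rho%:E * pi [set N].
Proof.
have := inflow_le_outflow p_semigroup p_rates exit_rate pi_stationary N.+1.
rewrite inflowE outflowE -(lee_pmul2l (_ : mu^-1%:E \is a fin_num))//.
  rewrite !muleA -!EFinM mulrCA mulVf ?gt_eqF// mulr1 => /le_trans; apply.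
  by rewrite [(_ * lambda)%R]mulrC.
by rewrite lte_fin invr_gt0.
Qed.

(** The mean is the sum of the tails, and the tail above N is at most rho pi_N, so
    the mean is at most rho. *)
Lemma mean_fin : \int[pi]_i (i%:R)%:E < +oo.
Proof.
have -> : \int[pi]_i (i%:R)%:E = \int[pi]_i (\sum_(j < i) 1)%:E.
  by apply: eq_integral => i _; rewrite sumr_const card_ord.
rewrite (integral_tails pi (w := cst 1%R))//.
apply: (@le_lt_trans _ _ (\sum_(0 <= j <oo) (rho%:E * (1%:E * pi [set j])))).
  apply: lee_nneseries => j _; first by rewrite mul1e.
  rewrite !mul1e; apply: le_trans (tail_le j).
  by rewrite -[leLHS]mul1e lee_wpmul2r// lee_fin ler1n.
rewrite nneseriesZl ?(-integral_nat_measure)//; last first.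
  by move=> j _; rewrite mul1e.
rewrite -(integral_nat_measure pi (w := cst 1%R))//.
rewrite (integral_cst pi measurableT 1%:E) mul1e.
rewrite [X in _ * X](_ : _ = 1) ?mule1 ?ltry//; exact: probability_setT.
Qed.

Lemma integrable_exit_rate :
  pi.-integrable setT (EFin \o (fun i : nat => lambda + i%:R * mu)%R).
Proof.
rewrite (_ : _ \o _ = cst lambda%:E \+ (fun i => mu%:E * (i%:R)%:E)); last first.
  by apply/funext => i /=; rewrite -EFinM -EFinD [(mu * _)%R]mulrC.
apply: integrableD => //; first exact: finite_measure_integrable_cst.
apply: integrableZl => //; apply/integrableP; split => //.
rewrite (le_lt_trans _ mean_fin)// le_eqVlt; apply/orP; left; apply/eqP.
by apply: eq_integral => i _; rewrite gee0_abs.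
Qed.

Lemma tail_balance N : N.+1%:R%:E * pi (~` `I_N.+1) = rho%:E * pi [set N].
Proof.
have := flow_balance p_semigroup p_rates exit_rate pi_stationary N.+1
  integrable_exit_rate.
rewrite inflowE outflowE => /(congr1 (mule mu^-1%:E)).
rewrite !muleA -!EFinM mulrCA mulVf ?gt_eqF// mulr1 => ->.
by rewrite [(_ * lambda)%R]mulrC.
Qed.

Let moment n : \bar R := \int[pi]_i ((i ^_ n)%:R)%:E.

Lemma moment_balance n :
  rho%:E * moment n = n.+2%:R^-1%:E * moment n.+2 + moment n.+1.
Proof.
rewrite /moment integral_nat_measure// -nneseriesZl//.
have term j : rho%:E * ((j ^_ n)%:R%:E * pi [set j]) =
    ((j.+1 ^_ n.+1)%:R)%:E * pi (~` `I_j.+1).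
  by rewrite muleCA -tail_balance muleA -EFinM ffactSS natrM [(_ * _)%R]mulrC.
under eq_eseriesr do rewrite term.
rewrite -(integral_tails pi (w := fun j => (j.+1 ^_ n.+1)%:R))//.
rewrite -ge0_integralZl_EFin// ?invr_ge0// -ge0_integralD//.
apply: eq_integral => i _; rewrite -EFinM -EFinD; congr EFin.
apply: (mulfI (_ : n.+2%:R != 0)%R); first by rewrite pnatr_eq0.
rewrite mulrDr mulrA divff ?pnatr_eq0// mul1r -!natr_sum.
by rewrite -!natrM -natrD sum_ffactS.
Qed.

(** The balance equation bounds the moment of order n + 1 by rho times that of
    order n. *)
Lemma moment_fin n : moment n \is a fin_num.
Proof.
have moment_ge0 k : 0 <= moment k by apply: integral_ge0.
elim: n => [|n IH]; rewrite ge0_fin_numE//.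
  rewrite /moment (_ : \int[pi]_i _ = \int[pi]_i cst 1 i) ?integral_cst//.
  by rewrite mul1e (le_lt_trans (probability_le1 _ _))// ltry.
apply: (@le_lt_trans _ _ (rho%:E * moment n)).
  by rewrite moment_balance leeDr// mule_ge0// lee_fin invr_ge0.
by rewrite -ge0_fin_numE ?fin_numM// mule_ge0// lee_fin ltW.
Qed.

Lemma moment_recurrence n :
  moment n.+2 = n.+2%:R%:E * (rho%:E * moment n - moment n.+1).
Proof.
by rewrite moment_balance addeK ?moment_fin// muleA -EFinM divff ?mul1e.
Qed.

End batch_queue.

Theorem lemma3 (R : realType) (lambda mu : R)
    (lambda_gt0 : 0 < lambda) (mu_gt0 : 0 < mu) (disc : discipline)
    (p : R -> R.-pker nat ~> nat)
    (p_semigroup : transition_semigroup p)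
    (p_rates : has_rates p (batch_rate disc lambda mu))
    (d : measure_display) (T : measurableType d) (P : probability T R)
    (Qoo : {RV P >-> nat})
    (Qoo_stationary : stationary p (distribution P Qoo)) (n : nat) :
  let rho := lambda / mu in
  let m := factorial_moment P Qoo in
  (m n.+2 = (n.+2)%:R%:E * (rho%:E * m n - m n.+1))%E.
Proof.
move=> rho m.
have mE k : m k = (\int[distribution P Qoo]_i ((i ^_ k)%:R)%:E)%E.
  rewrite ge0_integral_distribution// /m /factorial_moment unlock.
  by apply: eq_integral => x _ /=; rewrite prod_factors_ffact.
rewrite !mE; exact: moment_recurrence p_semigroup p_rates Qoo_stationary n.
Qed.
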